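(* Let $\Theta_{3,5,5}$ be the graph consisting of two vertices $w,w'$ joined by three internally vertex-disjoint paths of lengths $3$, $5$ and $5$. Then $\mathrm{ex}(n,\Theta_{3,5,5})=\Theta(n^{5/4})$.
   Context: For a graph $H$, $\mathrm{ex}(n,H)$ denotes the maximum number of edges in a graph on $n$ vertices that contains no subgraph isomorphic to $H$. *)

(* Defs.v *)
From mathcomp Require Import all_boot.
Set Implicit Arguments. Unset Strict Implicit. Unset Printing Implicit Defensive.

Definition simple_graph (T : finType) (E : {set {set T}}) : bool :=
  [forall e in E, #|e| == 2].

Definition contains_copy (V T : finType) (EH : {set {set V}}) (E : {set {set T}}) : bool :=
  [exists f : {ffun V -> T}, injectiveb f && [forall e in EH, (f @: e) \in E]].

Definition ex (V : finType) (EH : {set {set V}}) (n : nat) : nat :=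
  \max_(E : {set {set 'I_n}} | simple_graph E && ~~ contains_copy EH E) #|E|.

Definition path_edges (T : finType) (s : seq T) : {set {set T}} :=
  [set e : {set T} | has (fun p => e == [set p.1; p.2]) (zip s (behead s))].

Definition v12 (k : nat) : 'I_12 := inord k.
Definition theta355 : {set {set 'I_12}} :=
  path_edges (map v12 [:: 0; 2; 3; 1]) :|:
  path_edges (map v12 [:: 0; 4; 5; 6; 7; 1]) :|:
  path_edges (map v12 [:: 0; 8; 9; 10; 11; 1]).

(* Main.v *)
Require Import Defs.
From mathcomp Require Import all_boot all_order all_algebra all_field zify ring.
Set Implicit Arguments. Unset Strict Implicit. Unset Printing Implicit Defensive.

(** Lower bound: take the points of F^4 (|F| = q) and the lines whose direction
    lies on the moment curve (1, t, t^2, t^3). Any four of these directions are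
    independent, so in an octagon of points and lines the lines are parallel in
    pairs. The two octagons of a theta graph formed by its 3-path and one of
    its 5-paths then force the two 5-paths to leave the end point w along the
    same line. This theta-free graph has 2q^4 vertices and q^5 edges.

    Upper bound: pass to a bipartite graph of minimum degree more than k and
    explore it breadth first from a vertex x. If consecutive layers L_i,
    L_{i+1} (i <= 3) span at most 45(|L_i| + |L_{i+1}|) edges, then each layer
    is larger than the previous one by a factor of order k, whence k^4 = O(n).
    To bound these edges, colour the vertices of L_i by the child of the root
    above them. Vertices of L_{i+1} that see many colours produce a theta
    rooted at x; the others keep only their majority colour, which replaces x
    by one of its children and so decreases the depth. *)

(** * Theta graphs as triples of paths *)

(** Paths of a relation make sense on any vertex type, in particular on layers of a graph and on
    points and lines. *)
Definition has_theta (T : eqType) (r : rel T) : Prop :=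
  exists w w' x1 x2 y1 y2 y3 y4 z1 z2 z3 z4 : T,
  [/\ uniq [:: w; w'; x1; x2; y1; y2; y3; y4; z1; z2; z3; z4],
      path r w [:: x1; x2; w'], path r w [:: y1; y2; y3; y4; w']
    & path r w [:: z1; z2; z3; z4; w']].

Lemma sub_has_theta (T : eqType) (r r' : rel T) :
  subrel r r' -> has_theta r -> has_theta r'.
Proof.
move=> rr' [w [w' [x1 [x2 [y1 [y2 [y3 [y4 [z1 [z2 [z3 [z4 [U px py pz]]]]]]]]]]]]].
exists w, w', x1, x2, y1, y2, y3, y4, z1, z2, z3, z4.
by split=> //; [move: px | move: py | move: pz]; apply: sub_path.
Qed.

Lemma set_pair_path_edges (T : finType) (s : seq T) (x y : T) :
  (x, y) \in zip s (behead s) -> [set x; y] \in path_edges s.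
Proof. by move=> xy; rewrite inE; apply/hasP; exists (x, y). Qed.

Lemma contains_theta355P (T : finType) (E : {set {set T}}) :
  reflect (has_theta (fun u v => [set u; v] \in E)) (contains_copy theta355 E).
Proof.
apply: (iffP existsP) => [[f /andP[/injectiveP f_inj /forall_inP fE]]|].
  have fpath s x : path_edges (x :: s) \subset theta355 ->
      path (fun u v => [set u; v] \in E) (f x) [seq f i | i <- s].
    elim: s x => //= y s IHs x sub; apply/andP; split.
      rewrite -(imset_set1 f x) -(imset_set1 f y) -imsetU fE //.
      by rewrite (subsetP sub) // set_pair_path_edges //= inE eqxx.
    apply/IHs/(subset_trans _ sub)/subsetP => e; rewrite !inE /= => h.
    by apply/orP; right.
  exists (f (v12 0)), (f (v12 1)), (f (v12 2)), (f (v12 3)), (f (v12 4)),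
    (f (v12 5)), (f (v12 6)), (f (v12 7)), (f (v12 8)), (f (v12 9)),
    (f (v12 10)), (f (v12 11)); split.
  - change (is_true (uniq (map f (map v12 (iota 0 12))))).
    by rewrite (map_inj_uniq f_inj) -(map_inj_uniq val_inj) /= !inordK.
  - apply: (fpath [:: v12 2; v12 3; v12 1]).
    by rewrite /theta355 -setUA subsetUl.
  - apply: (fpath [:: v12 4; v12 5; v12 6; v12 7; v12 1]).
    by rewrite /theta355 setUAC subsetUr.
  - apply: (fpath [:: v12 8; v12 9; v12 10; v12 11; v12 1]).
    by rewrite /theta355 subsetUr.
move=> [w [w' [x1 [x2 [y1 [y2 [y3 [y4 [z1 [z2 [z3 [z4 [U px py pz]]]]]]]]]]]]].
(* The order of [s] is the numbering of [theta355]: ends 0 and 1, then interiors 2-3, 4-7 and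
   8-11. *)
set s := [:: w; _; _; _; _; _; _; _; _; _; _; _] in U.
exists [ffun i : 'I_12 => nth w s i]; apply/andP; split.
  apply/injectiveP => i j; rewrite !ffunE => /eqP.
  by rewrite nth_uniq ?ltn_ord // => /eqP/val_inj.
have fv k : (k < 12)%N -> [ffun i : 'I_12 => nth w s i] (v12 k) = nth w s k.
  by move=> lk; rewrite ffunE inordK.
apply/forall_inP => e.
move: px py pz => /= /and4P[e1 e2 e3 _] /and5P[e4 e5 e6 e7 /andP[e8 _]].
move=> /and5P[e9 e10 e11 e12 /andP[e13 _]].
rewrite 2!inE => /orP[/orP[]|]; rewrite inE /= !orbF => he;
  by repeat (case/orP: he => [/eqP->|he]; first by rewrite imsetU !imset_set1 !fv);
  move/eqP: he => ->; rewrite imsetU !imset_set1 !fv.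
Qed.

(** * Edge counts, large minimum degree and cuts *)

Lemma pick_notin (T : finType) (S : {set T}) (s : seq T) :
  size s < #|S| -> exists2 x, x \in S & x \notin s.
Proof.
move=> lt_sS; have /subsetPn[x xS xs] : ~~ (S \subset s).
  by apply: contraL lt_sS => /subset_leq_card le; rewrite -leqNgt (leq_trans le) ?card_size.
by exists x.
Qed.

Section EdgeCount.
Variables (T : finType) (r : rel T).
Hypothesis r_sym : symmetric r.
Implicit Types A B C : {set T}.

Definition nbrs (B : {set T}) (x : T) : {set T} := [set y in B | r x y].
(** Pairs are ordered, so [edges_between U U] counts each edge of a loopless symmetric graph
    twice. *)
Definition edges_between (A B : {set T}) : nat := \sum_(x in A) #|nbrs B x|.

Lemma in_nbrs B x y : (y \in nbrs B x) = (y \in B) && r x y.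
Proof. by rewrite inE. Qed.

Lemma edges_betweenC A B : edges_between A B = edges_between B A.
Proof.
rewrite /edges_between.
under eq_bigr do rewrite -sum1_card.
under [RHS]eq_bigr do rewrite -sum1_card.
rewrite (exchange_big_dep (mem B)) /=; last by move=> x y _; rewrite inE => /andP[].
by apply: eq_bigr => y yB; apply: eq_bigl => x; rewrite !inE yB r_sym.
Qed.

Lemma edges_betweenD A B C :
  edges_between A B = edges_between A (B :&: C) + edges_between A (B :\: C).
Proof.
rewrite -big_split /=; apply: eq_bigr => x _.
rewrite -(cardsID C (nbrs B x)).
by congr addn; apply: eq_card => y; rewrite !inE; case: (y \in C); rewrite ?andbF ?andbT.
Qed.

Lemma edges_betweenD1 A B a : a \in A ->
  edges_between A B = #|nbrs B a| + edges_between (A :\ a) B.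
Proof. by move=> aA; rewrite /edges_between (big_setD1 a). Qed.

(** Deleting a vertex of degree at most [k] lowers the left side by [k] and the right side by at
    most [k], so the strict inequality survives until no such vertex is left; it also forbids an
    empty [A]. *)
Lemma min_degree_subpair k A B : k * (#|A| + #|B|) < edges_between A B ->
  exists A' B', [/\ A' \subset A, B' \subset B, A' != set0,
    forall a, a \in A' -> k < #|nbrs B' a| & forall b, b \in B' -> k < #|nbrs A' b|].
Proof.
have [m] := ubnP (#|A| + #|B|); elim: m A B => // m IHm A B le_m dense.
case: (pickP [pred a in A | #|nbrs B a| <= k]) => [a /andP[/= aA da]|noA].
  have [||A' [B' [sA sB n0 dA dB]]] := IHm (A :\ a) B.
  - by move: le_m; rewrite (cardsD1 a A) aA; lia.
  - by move: dense; rewrite (edges_betweenD1 _ aA) (cardsD1 a A) aA; nia.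
  by exists A', B'; split=> //; apply: subset_trans sA (subD1set _ _).
case: (pickP [pred b in B | #|nbrs A b| <= k]) => [b /andP[/= bB db]|noB].
  have [||A' [B' [sA sB n0 dA dB]]] := IHm A (B :\ b).
  - by move: le_m; rewrite (cardsD1 b B) bB; lia.
  - move: dense; rewrite edges_betweenC (edges_betweenD1 _ bB) (cardsD1 b B) bB.
    by rewrite (edges_betweenC A); nia.
  by exists A', B'; split=> //; apply: subset_trans sB (subD1set _ _).
exists A, B; split=> //.
- by apply: contraTneq dense => ->; rewrite /edges_between big_set0.
- by move=> a aA; have := noA a; rewrite /= aA /= leqNgt => /negbFE.
- by move=> b bB; have := noB b; rewrite /= bB /= leqNgt => /negbFE.
Qed.

(* Each vertex of [B] keeps only the edges to its most frequent colour. *)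
Lemma edges_between_few_colours (col : T -> T) A B m k :
    (forall b, b \in B -> #|col @: nbrs A b| <= m) ->
    (forall c B', B' \subset B ->
       edges_between [set a in A | col a == c] B'
         <= k * (#|[set a in A | col a == c]| + #|B'|)) ->
  edges_between A B <= m * k * (#|A| + #|B|).
Proof.
move=> few mono; pose Ac c := [set a in A | col a == c].
pose f b := [arg max_(c > b) #|nbrs (Ac c) b|].
have maxf b c : #|nbrs (Ac c) b| <= #|nbrs (Ac (f b)) b|.
  by rewrite /f; case: arg_maxnP => // c' _; apply.
have deg b : b \in B -> #|nbrs A b| <= m * #|nbrs (Ac (f b)) b|.
  move=> bB; rewrite -sum1_card (partition_big_imset col) /=.
  apply: (@leq_trans (\sum_(c in col @: nbrs A b) #|nbrs (Ac (f b)) b|)).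
    apply: leq_sum => c _; rewrite sum1_card; apply: leq_trans (maxf b c).
    by apply: eq_leq; apply: eq_card => a; rewrite !inE unfold_in /= inE andbAC.
  by rewrite sum_nat_const leq_mul2r few ?orbT.
rewrite edges_betweenC; apply: leq_trans (leq_sum _ deg) _.
rewrite -big_distrr /= -mulnA leq_mul2l; apply/orP; right.
(* The colour classes partition [A] and the fibres of [f] partition [B], so the bounds for single
   colours add up without loss. *)
rewrite (partition_big f predT) //=.
have partA : #|A| = \sum_c #|Ac c|.
  rewrite -sum1_card (partition_big col predT) //=; apply: eq_bigr => c _.
  by rewrite -sum1_card; apply: eq_bigl => a; rewrite inE.
have partB : #|B| = \sum_c #|[set b in B | f b == c]|.
  rewrite -sum1_card (partition_big f predT) //=; apply: eq_bigr => c _.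
  by rewrite -sum1_card; apply: eq_bigl => a; rewrite inE.
rewrite partA partB -big_split big_distrr /=; apply: leq_sum => c _.
have sub : [set b in B | f b == c] \subset B by apply/subsetP => b; rewrite inE => /andP[].
apply: leq_trans (mono c _ sub); rewrite edges_betweenC /edges_between.
rewrite [leqRHS](eq_bigl (fun b => (b \in B) && (f b == c))); last by move=> b; rewrite inE.
by rewrite leq_eqVlt; apply/orP; left; apply/eqP/eq_bigr => b /andP[_ /eqP->].
Qed.

(** Greedy cut: each vertex joins the side where it has fewer neighbours, so at least half of the
    edges cross. The other factor 2 comes from the double counting on the left. *)
Lemma dense_cut (U : {set T}) : irreflexive r ->
  exists2 S : {set T}, S \subset U & edges_between U U <= 4 * edges_between S (U :\: S).
Proof.
move=> irr; have [m] := ubnP #|U|; elim: m U => // m IHm U le_m.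
have [->|[a aU]] := set_0Vmem U.
  by exists set0; rewrite ?sub0set // /edges_between big_set0.
have [|S sSU cutS] := IHm (U :\ a); first by move: le_m; rewrite (cardsD1 a U) aU.
have aS : a \notin S by apply: contraTN isT => /(subsetP sSU); rewrite !inE eqxx.
have sS : S \subset U := subset_trans sSU (subD1set _ _).
have deg : #|nbrs U a| = #|nbrs (U :\ a) a|.
  by apply: eq_card => y; rewrite !inE; case: eqP => //= ->; rewrite irr andbF.
have degS : #|nbrs (U :\ a) a| = #|nbrs S a| + #|nbrs (U :\ a :\: S) a|.
  rewrite -(cardsID S); congr addn; apply: eq_card => y; rewrite !inE.
    case yS: (y \in S); rewrite ?andbF //= andbT.
    by have := subsetP sSU _ yS; rewrite !inE => ->.
  by rewrite !andbA.
have eUU : edges_between U U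
    = 2 * #|nbrs (U :\ a) a| + edges_between (U :\ a) (U :\ a).
  by rewrite (edges_betweenD1 _ aU) edges_betweenC (edges_betweenD1 _ aU) deg; lia.
have [le|le] := leqP #|nbrs S a| #|nbrs (U :\ a :\: S) a|.
  exists (a |: S); first by rewrite subUset sub1set aU.
  have -> : U :\: (a |: S) = U :\ a :\: S by rewrite setDDl.
  rewrite (edges_betweenD1 _ (setU11 a S)) setU1K // eUU degS.
  by move: cutS le; lia.
exists S => //; rewrite edges_betweenC.
have aUS : a \in U :\: S by rewrite inE aS aU.
have -> : edges_between (U :\: S) S = #|nbrs S a| + edges_between S (U :\ a :\: S).
  by rewrite (edges_betweenD1 _ aUS) [in RHS]edges_betweenC setDDl setDDl setUC.
by move: cutS le; rewrite eUU degS; lia.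
Qed.

End EdgeCount.

(** * Few edges between consecutive layers *)

(** Distinctness is proved on a list grouped by level and carried to the vertex order of
    [has_theta]; [I] lists the positions. *)
Lemma map_nth_uniq (T : eqType) (x0 : T) (s : seq T) (I : seq nat) :
  uniq s -> uniq I -> all (gtn (size s)) I -> uniq [seq nth x0 s i | i <- I].
Proof.
move=> Us UI /allP lts; rewrite map_inj_in_uniq // => i j iI jI /eqP.
by rewrite (nth_uniq x0 (lts i iI) (lts j jI)) // => /eqP.
Qed.

Section Layers.
Variables (T : finType) (r : rel T) (p : T -> T) (lev : T -> nat).
Hypothesis r_sym : symmetric r.
Hypothesis lev_p : forall v i, lev v = i.+1 -> i < 4 -> lev (p v) = i /\ r (p v) v.
Hypothesis no_theta : ~ has_theta r.
Implicit Types A B : {set T}.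

(** Vertices on different levels differ, so distinctness is to be checked only within each level. *)
Lemma uniq_cat_lev (s t : seq T) i :
    all (fun v => lev v == i) s -> all (fun v => i < lev v) t ->
  uniq (s ++ t) = uniq s && uniq t.
Proof.
move=> /allP hs /allP ht; rewrite cat_uniq; case: hasP => // -[v /ht + /hs/eqP e].
by rewrite e ltnn.
Qed.

(* The theta joins [d] to the centre [w'] of a spider with legs 2, 4, 4. *)
Lemma few_edges_below_child d A B i : 0 < i < 4 ->
    {in A, forall a, lev a = i /\ p a = d} -> {in B, forall b, lev b = i.+1} ->
  edges_between r A B <= 5 * (#|A| + #|B|).
Proof.
case: i => // i lti levA levB; rewrite leqNgt; apply/negP => dense.
have [A' [B' [sA sB /set0Pn[w' w'A] dA dB]]] := min_degree_subpair r_sym dense.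
have {levA dense}levA a : a \in A' -> [/\ lev a = i.+1, r d a & lev d = i].
  by move=> /(subsetP sA)/levA[la <-]; have [] := lev_p la (ltnW lti).
have {levB}levB b : b \in B' -> lev b = i.+2 by move/(subsetP sB)/levB.
have stepA a s : a \in A' -> size s < 6 -> exists b, [/\ b \in B', r a b & b \notin s].
  move=> aA' szs; have [b + nb] := pick_notin (leq_trans szs (dA a aA')).
  by rewrite inE => /andP[]; exists b.
have stepB b s : b \in B' -> size s < 6 -> exists a, [/\ a \in A', r b a & a \notin s].
  move=> bB' szs; have [a + na] := pick_notin (leq_trans szs (dB b bB')).
  by rewrite inE => /andP[]; exists a.
(* The legs from [w'] are [b1 a1], [b2 a2 b3 a3] and [b4 a4 b5 a5]; their tips [a1], [a3], [a5] are
   children of [d]. At most five vertices are avoided at a time, whence the constant 5. *)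
have [b1 [b1B rb1 _]] := stepA w' [::] w'A isT.
have [a1 [a1A ra1 na1]] := stepB b1 [:: w'] b1B isT.
have [b2 [b2B rb2 nb2]] := stepA w' [:: b1] w'A isT.
have [a2 [a2A ra2 na2]] := stepB b2 [:: a1; w'] b2B isT.
have [b3 [b3B rb3 nb3]] := stepA a2 [:: b2; b1] a2A isT.
have [a3 [a3A ra3 na3]] := stepB b3 [:: a2; a1; w'] b3B isT.
have [b4 [b4B rb4 nb4]] := stepA w' [:: b3; b2; b1] w'A isT.
have [a4 [a4A ra4 na4]] := stepB b4 [:: a3; a2; a1; w'] b4B isT.
have [b5 [b5B rb5 nb5]] := stepA a4 [:: b4; b3; b2; b1] a4A isT.
have [a5 [a5A ra5 na5]] := stepB b5 [:: a4; a3; a2; a1; w'] b5B isT.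
have Ua : uniq [:: a5; a4; a3; a2; a1; w'] by rewrite /= na5 na4 na3 na2 na1.
have Ub : uniq [:: b5; b4; b3; b2; b1] by rewrite /= nb5 nb4 nb3 nb2.
have [lw _ ld] := levA _ w'A; have [l1 r1 _] := levA _ a1A; have [l2 _ _] := levA _ a2A.
have [l3 r3 _] := levA _ a3A; have [l4 _ _] := levA _ a4A; have [l5 r5 _] := levA _ a5A.
have U : uniq ([:: d] ++ [:: a5; a4; a3; a2; a1; w'] ++ [:: b5; b4; b3; b2; b1]).
  rewrite (@uniq_cat_lev _ _ i) 1?(@uniq_cat_lev _ _ i.+1) ?Ua ?Ub //=.
  - by rewrite lw l1 l2 l3 l4 l5 !eqxx.
  - by rewrite !levB // !leqnn.
  - by rewrite ld eqxx.
  - by rewrite lw l1 l2 l3 l4 l5 !levB // !leqnn !leqnSn.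
apply: no_theta; exists d, w', a1, b1, a3, b3, a2, b2, a5, b5, a4, b4; split.
- exact: (@map_nth_uniq _ d _ [:: 0; 6; 5; 11; 3; 9; 4; 10; 1; 7; 2; 8] U).
- by rewrite /= r1 r_sym ra1 r_sym rb1.
- by rewrite /= r3 r_sym ra3 r_sym rb3 r_sym ra2 r_sym rb2.
- by rewrite /= r5 r_sym ra5 r_sym rb5 r_sym ra4 r_sym rb4.
Qed.

(** Vertices of [B] are split by the number of parents they see in [A]. Those seeing at least five
    span few edges, else a theta joins [c] to some [b1]; the others have at most four colours, each
    handled by [few_edges_below_child]. The constant is 2 + 4 * 5. *)
Lemma few_edges_below_grandchild c A B i : 1 < i < 4 ->
    {in A, forall a, lev a = i /\ p (p a) = c} -> {in B, forall b, lev b = i.+1} ->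
  edges_between r A B <= 22 * (#|A| + #|B|).
Proof.
case: i => [|[|i]] // lti levA levB.
pose B2 := [set b | 4 < #|p @: nbrs r A b|].
have dense_part : edges_between r A (B :&: B2) <= 2 * (#|A| + #|B :&: B2|).
  rewrite leqNgt; apply/negP => dense.
  have [A' [B' [sA sB /set0Pn[a0 a0A] dA dB]]] := min_degree_subpair r_sym dense.
  have {levA dense}levA a : a \in A -> [/\ lev a = i.+2, lev (p a) = i.+1, lev c = i,
      r c (p a) & r (p a) a].
    move=> /levA[la <-]; have [lpa rpa] := lev_p la (ltnW lti).
    by have [] := lev_p lpa (ltnW (ltnW lti)).
  have {levB}levB b : b \in B' -> lev b = i.+3.
    by move/(subsetP sB); rewrite inE => /andP[/levB].
  have stepA a s : a \in A' -> size s < 3 -> exists b, [/\ b \in B', r a b & b \notin s].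
    move=> aA' szs; have [b + nb] := pick_notin (leq_trans szs (dA a aA')).
    by rewrite inE => /andP[]; exists b.
  have stepB b s : b \in B' -> size s < 3 -> exists a, [/\ a \in A', r b a & a \notin s].
    move=> bB' szs; have [a + na] := pick_notin (leq_trans szs (dB b bB')).
    by rewrite inE => /andP[]; exists a.
  have leapB b s : b \in B' -> size s < 5 -> exists a, [/\ a \in A, r b a & p a \notin s].
    move=> /(subsetP sB); rewrite !inE => /andP[_ pb] szs.
    have [_ /imsetP[a + ->] na] := pick_notin (leq_trans szs pb).
    by rewrite inE => /andP[]; exists a.
  (* From [b1] go [a1] and the two paths [a2 b2 a4], [a3 b3 a5]. The parents of [a4] and [a5] are
     chosen new, so that the three climbs to [c] stay disjoint. *)
  have [b1 [b1B rb1 _]] := stepA a0 [::] a0A isT.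
  have [a1 [a1A ra1 _]] := stepB b1 [::] b1B isT.
  have [a2 [a2A ra2 na2]] := stepB b1 [:: a1] b1B isT.
  have [a3 [a3A ra3 na3]] := stepB b1 [:: a2; a1] b1B isT.
  have [b2 [b2B rb2 nb2]] := stepA a2 [:: b1] a2A isT.
  have [b3 [b3B rb3 nb3]] := stepA a3 [:: b2; b1] a3A isT.
  have [a4 [a4A ra4 np4]] := leapB b2 (map p [:: a3; a2; a1]) b2B isT.
  have [a5 [a5A ra5 np5]] := leapB b3 (map p [:: a4; a3; a2; a1]) b3B isT.
  have na4 := contra (@map_f _ _ p _ _) np4; have na5 := contra (@map_f _ _ p _ _) np5.
  have Ua : uniq [:: a5; a4; a3; a2; a1] by rewrite /= na5 na4 na3 na2.
  have Ub : uniq [:: b3; b2; b1] by rewrite /= nb3 nb2.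
  have Up : uniq [:: p a5; p a4; p a1].
    move: np4 np5; rewrite /= !inE !negb_or.
    by move=> /and3P[_ _ ->] /and4P[-> _ _ ->].
  have [l1 lp1 lc rc1 rp1] := levA _ (subsetP sA _ a1A).
  have [l2 _ _ _ _] := levA _ (subsetP sA _ a2A).
  have [l3 _ _ _ _] := levA _ (subsetP sA _ a3A).
  have [l4 lp4 _ rc4 rp4] := levA _ a4A; have [l5 lp5 _ rc5 rp5] := levA _ a5A.
  have m1 := levB _ b1B; have m2 := levB _ b2B; have m3 := levB _ b3B.
  have U : uniq ([:: c] ++ [:: p a5; p a4; p a1] ++ [:: a5; a4; a3; a2; a1]
                 ++ [:: b3; b2; b1]).
    rewrite (@uniq_cat_lev _ _ i) 1?(@uniq_cat_lev _ _ i.+1)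
      1?(@uniq_cat_lev _ _ i.+2) ?Ua ?Ub ?Up //=;
      by rewrite ?lc ?lp1 ?lp4 ?lp5 ?l1 ?l2 ?l3 ?l4 ?l5 ?m1 ?m2 ?m3; clear; lia.
  apply: no_theta; exists c, b1, (p a1), a1, (p a4), a4, b2, a2, (p a5), a5, b3, a3; split.
  - exact: (@map_nth_uniq _ c _ [:: 0; 11; 3; 8; 2; 5; 10; 7; 1; 4; 9; 6] U).
  - by rewrite /= rc1 rp1 r_sym ra1.
  - by rewrite /= rc4 rp4 r_sym ra4 r_sym rb2 r_sym ra2.
  - by rewrite /= rc5 rp5 r_sym ra5 r_sym rb3 r_sym ra3.
have sparse_part : edges_between r A (B :\: B2) <= 4 * 5 * (#|A| + #|B :\: B2|).
  apply: (edges_between_few_colours r_sym (col := p)) => // [b|d B' sB].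
    by rewrite !inE -leqNgt => /andP[].
  apply: (@few_edges_below_child d _ _ i.+2) => // [a|b /(subsetP sB)].
    by rewrite inE => /andP[/levA[-> _] /eqP].
  by rewrite inE => /andP[_ /levB].
by rewrite (edges_betweenD _ _ _ B2) -(cardsID B2 B); lia.
Qed.

(** The colour is now the grandparent, a child of [x]. If [a] has two neighbours that see three
    colours each, a theta joins [x] to [a], so such vertices receive at most one edge from each [a].
    The rest costs 2 * 22, giving 45 in total. *)
Lemma few_edges_below_root x A B :
    {in A, forall a, lev a = 3 /\ p (p (p a)) = x} -> {in B, forall b, lev b = 4} ->
  edges_between r A B <= 45 * (#|A| + #|B|).
Proof.
move=> levA levB.
pose B2 := [set b | 2 < #|[set p (p a) | a in nbrs r A b]|].
have dense_part : edges_between r A (B :&: B2) <= #|A|.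
  rewrite -sum1_card; apply: leq_sum => a aA; rewrite leqNgt; apply/negP.
  have {}levA a' : a' \in A -> [/\ lev a' = 3, lev (p a') = 2, lev (p (p a')) = 1 & lev x = 0]
      /\ path r x [:: p (p a'); p a'; a'].
    move=> /levA[la <-]; have [lpa rpa] := lev_p la isT.
    by have [lppa rppa] := lev_p lpa isT; have [? /= ->] := lev_p lppa isT; rewrite rppa rpa.
  case/card_gt1P => b1 [b2 []]; rewrite !inE.
  move=> /andP[/andP[/levB m1 c1] rab1] /andP[/andP[/levB m2 c2] rab2] b12.
  have leap b s : 2 < #|[set p (p a) | a in nbrs r A b]| -> size s < 3 ->
      exists a, [/\ a \in A, r b a & p (p a) \notin s].
    move=> cb szs; have [_ /imsetP[a' + ->] na] := pick_notin (leq_trans szs cb).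
    by rewrite inE => /andP[]; exists a'.
  have [a1 [a1A ra1 nc1]] := leap b1 [:: p (p a)] c1 isT.
  have [a2 [a2A ra2 nc2]] := leap b2 [:: p (p a1); p (p a)] c2 isT.
  (* Distinct grandparents force distinct parents and distinct vertices. *)
  have Uc : uniq (map p (map p [:: a2; a1; a])) by rewrite /= nc2 nc1.
  have Up : uniq (map p [:: a2; a1; a]) := map_uniq Uc.
  have Ua : uniq [:: a2; a1; a] := map_uniq Up.
  have Ub : uniq [:: b2; b1] by rewrite /= inE eq_sym b12.
  have [[l0 lp0 lc0 lx] pa] := levA _ aA.
  have [[l1 lp1 lc1 _] pa1] := levA _ a1A; have [[l2 lp2 lc2 _] pa2] := levA _ a2A.
  have U : uniq ([:: x] ++ map p (map p [:: a2; a1; a]) ++ map p [:: a2; a1; a]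
                 ++ [:: a2; a1; a] ++ [:: b2; b1]).
    rewrite (@uniq_cat_lev _ _ 0) 1?(@uniq_cat_lev _ _ 1) 1?(@uniq_cat_lev _ _ 2)
      1?(@uniq_cat_lev _ _ 3) ?Ua ?Ub ?Up ?Uc //=;
      by rewrite ?lx ?lc0 ?lc1 ?lc2 ?lp0 ?lp1 ?lp2 ?l0 ?l1 ?l2 ?m1 ?m2.
  apply: no_theta; exists x, a, (p (p a)), (p a), (p (p a1)), (p a1), a1, b1,
    (p (p a2)), (p a2), a2, b2; split=> //.
  - exact: (@map_nth_uniq _ x _ [:: 0; 9; 3; 6; 2; 5; 8; 11; 1; 4; 7; 10] U).
  - by rewrite -[_ :: _]/([:: p (p a1); p a1; a1] ++ [:: b1; a]) cat_path pa1 /= r_sym ra1 r_sym rab1.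
  - by rewrite -[_ :: _]/([:: p (p a2); p a2; a2] ++ [:: b2; a]) cat_path pa2 /= r_sym ra2 r_sym rab2.
have sparse_part : edges_between r A (B :\: B2) <= 2 * 22 * (#|A| + #|B :\: B2|).
  apply: (edges_between_few_colours r_sym (col := fun a => p (p a))) => // [b|c B' sB].
    by rewrite !inE -leqNgt => /andP[].
  apply: (@few_edges_below_grandchild c _ _ 3) => // [a|b /(subsetP sB)].
    by rewrite inE => /andP[/levA[-> _] /eqP].
  by rewrite inE => /andP[_ /levB].
by rewrite (edges_betweenD _ _ _ B2) -(cardsID B2 B); lia.
Qed.

End Layers.

(** * Breadth-first layers of a bipartite graph *)

Section BreadthFirst.
Variables (T : finType) (r : rel T) (S : {set T}) (x : T).
Hypothesis r_sym : symmetric r.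
Hypothesis r_bip : forall u v, r u v -> (u \in S) != (v \in S).

Definition neighbourhood (A : {set T}) : {set T} := [set v | [exists u in A, r u v]].

(** Each step removes only the layer two steps back; bipartiteness makes all layers disjoint, see
    [layer_disjoint]. *)
Fixpoint layer (i : nat) : {set T} :=
  if i is j.+1 then neighbourhood (layer j) :\: (if j is h.+1 then layer h else set0)
  else [set x].

(** Vertices outside layers 0 to 4 get the value 5. *)
Definition level (v : T) : nat := find (fun i => v \in layer i) (iota 0 5).

Definition parent (v : T) : T := odflt v [pick u | r u v && ((level u).+1 == level v)].

Lemma layer_parent i v : v \in layer i.+1 -> exists2 u, u \in layer i & r u v.
Proof. by rewrite inE => /andP[_]; rewrite inE => /exists_inP[u]; exists u. Qed.

Lemma layer_side i v : v \in layer i -> (v \in S) = odd i (+) (x \in S).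
Proof.
elim: i v => [v|i IHi v /layer_parent[u /IHi Hu /r_bip]]; first by rewrite !inE => /eqP->.
by rewrite Hu /=; case: (odd i); case: (x \in S); case: (v \in S).
Qed.

Lemma layer_neighbour i u v : u \in layer i.+1 -> r u v -> v \in layer i :|: layer i.+2.
Proof.
move=> ui ruv; rewrite in_setU; have [//|vi /=] := boolP (v \in layer i).
by rewrite inE vi inE; apply/exists_inP; exists u.
Qed.

Lemma layer_disjoint i j v : i < j -> v \in layer i -> v \notin layer j.
Proof.
elim: j i v => // j IHj i v ltij vi; apply/negP => vj.
(* Consecutive layers lie on opposite sides of the bipartition. *)
have [ij|neq_ij] := eqVneq i j.
  move: (layer_side vi); rewrite (layer_side vj) ij /=.
  by case: (odd j); case: (x \in S).
have {ltij neq_ij}ltij : i < j by lia.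
case: j ltij IHj vj => // j ltij IHj vj; have [u uj ruv] := layer_parent vj.
(* Layers two apart are disjoint by definition. Otherwise [u] is adjacent to [v] in layer [i], so it
   lies in a layer next to [i], against the induction hypothesis. *)
have [ij|neq_ij] := eqVneq i j.
  by move: vj; rewrite -ij inE vi.
have {ltij neq_ij}ltij : i < j by lia.
case: i vi ltij => [vi|i vi] ltij.
  have u1 : u \in layer 1.
    by rewrite /= setD0 inE; apply/exists_inP; exists v; rewrite // r_sym.
  by have /negP := IHj _ _ (ltij : 1 < j.+1) u1.
have : u \in layer i :|: layer i.+2 by apply: (layer_neighbour vi); rewrite r_sym.
rewrite in_setU => /orP[] ui.
  by have /negP := IHj i u (ltnW (ltnW ltij)) ui.
by have /negP := IHj i.+2 u ltij ui.
Qed.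

Lemma level_layer i v : i < 5 -> v \in layer i -> level v = i.
Proof.
move=> lti vi; have hasP : has (fun i => v \in layer i) (iota 0 5).
  by apply/hasP; exists i; rewrite ?mem_iota.
have := nth_find 0 hasP; rewrite -/(level v) nth_iota => [vl|]; last first.
  by move: hasP; rewrite has_find size_iota.
have [lt|lt|//] := ltngtP (level v) i.
  by have /negP := layer_disjoint lt vl.
by have /negP := layer_disjoint lt vi.
Qed.

Lemma layer_level i v : i < 5 -> level v = i -> v \in layer i.
Proof.
move=> lti lv; have hasP : has (fun i => v \in layer i) (iota 0 5).
  by rewrite has_find size_iota -/(level v) lv.
by have := nth_find 0 hasP; rewrite -/(level v) nth_iota lv.
Qed.

Lemma level_parent v i : level v = i.+1 -> i < 4 -> level (parent v) = i /\ r (parent v) v.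
Proof.
move=> lv lti; have [u ui ruv] := layer_parent (layer_level (lti : i.+1 < 5) lv).
rewrite /parent; case: pickP => [w /andP[rwv]|/(_ u)].
  by rewrite lv eqSS => /eqP.
by rewrite ruv lv (level_layer (ltnW (lti : i.+1 < 5)) ui) eqxx.
Qed.

(** As [a <= b], the right side is at most [135 * b + 45 * c], and [k >= 270] lets half of [k * b]
    absorb [135 * b]. *)
Lemma layer_growth a b c k : 270 <= k -> a <= b ->
  k * b <= 45 * (a + b) + 45 * (b + c) -> k * b <= 90 * c /\ b <= c.
Proof.
move=> k270 ab h; have kb : 270 * b <= k * b by rewrite leq_mul2r k270 orbT.
by split; lia.
Qed.

Hypothesis no_theta : ~ has_theta r.

(** The first layer has at least [k] vertices, and each of the next three grows by a factor of at
    least [k / 90]. *)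
Lemma min_degree_bound k : 270 <= k -> (exists y, r x y) ->
  (forall u v, r u v -> k < #|nbrs r setT u|) -> k ^ 4 <= 90 ^ 3 * #|T|.
Proof.
move=> k270 [y rxy] deg.
pose l i := #|layer i|.
have deg_layer i : k * l i.+1 <= edges_between r (layer i.+1) (layer i)
                               + edges_between r (layer i.+1) (layer i.+2).
  rewrite mulnC -sum_nat_const -big_split /=; apply: leq_sum => u ui.
  have [w _ rwu] := layer_parent ui; rewrite r_sym in rwu.
  apply: leq_trans (ltnW (deg _ _ rwu)) (leq_trans (subset_leq_card _) (leq_card_setU _ _)).
  apply/subsetP => v; rewrite in_nbrs => /andP[_ ruv].
  by have := layer_neighbour ui ruv; rewrite !in_setU !in_nbrs ruv !andbT.
have levL i : i < 5 -> {in layer i, forall v, level v = i}.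
  by move=> lti v; apply: level_layer.
have root v : level v = 0 -> v = x by move=> /(@layer_level 0 v isT); rewrite inE => /eqP.
have par v i : level v = i.+1 -> i < 4 -> level (parent v) = i.
  by move=> lv /(level_parent lv)[].
have e01 : edges_between r (layer 1) (layer 0) <= l 1.
  rewrite /l -sum1_card; apply: leq_sum => u _; rewrite -(cards1 x).
  by apply/subset_leq_card/subsetP => v; rewrite in_nbrs => /andP[].
(* All parent chains end at [x], so [x] serves as the child, the grandchild and the root of the
   three layer lemmas in turn. *)
have e12 : edges_between r (layer 1) (layer 2) <= 5 * (l 1 + l 2).
  apply: (few_edges_below_child r_sym level_parent no_theta (d := x) (i := 1)) => //.
    by move=> a /(levL 1 isT) la; split=> //; exact: root (par _ _ la isT).
  exact: levL.
have e23 : edges_between r (layer 2) (layer 3) <= 22 * (l 2 + l 3).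
  apply: (few_edges_below_grandchild r_sym level_parent no_theta (c := x) (i := 2)) => //.
    by move=> a /(levL 2 isT) la; split=> //; exact: root (par _ _ (par _ _ la isT) isT).
  exact: levL.
have e34 : edges_between r (layer 3) (layer 4) <= 45 * (l 3 + l 4).
  apply: (few_edges_below_root r_sym level_parent no_theta (x := x)) => //.
    by move=> a /(levL 3 isT) la; split=> //; exact: root (par _ _ (par _ _ (par _ _ la isT) isT) isT).
  exact: levL.
have l1 : k <= l 1.
  apply: ltnW (leq_trans (deg _ _ rxy) (subset_leq_card _)); apply/subsetP => v.
  rewrite in_nbrs => /andP[_ rxv]; rewrite /= setD0 inE.
  by apply/exists_inP; exists x; rewrite ?inE.
have := deg_layer 0; have := deg_layer 1; have := deg_layer 2.
rewrite (edges_betweenC r_sym (layer 2)) (edges_betweenC r_sym (layer 3) (layer 2)).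
move=> d3 d2 d1.
(* The single edge from each vertex of layer 1 to [x] is absorbed in [45 * l 1], so the previous
   layer may be taken as 0. *)
have [g1 l12] : k * l 1 <= 90 * l 2 /\ l 1 <= l 2.
  by apply: (@layer_growth 0) => //; lia.
have [g2 l23] : k * l 2 <= 90 * l 3 /\ l 2 <= l 3.
  by apply: (@layer_growth (l 1)) => //; lia.
have [g3 _] : k * l 3 <= 90 * l 4 /\ l 3 <= l 4.
  by apply: (@layer_growth (l 2)) => //; lia.
have l4 : l 4 <= #|T| := max_card _.
apply: leq_trans (leq_mul (leqnn _) l4).
rewrite !expnS !expn0 !muln1 -!mulnA.
apply: leq_trans (_ : k * (k * (k * l 1)) <= _); first by rewrite 3!leq_mul2l l1 !orbT.
apply: leq_trans (_ : k * (k * (90 * l 2)) <= _); first by rewrite 2!leq_mul2l g1 !orbT.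
rewrite (mulnCA k 90) (mulnCA k 90) leq_mul2l /=.
apply: leq_trans (_ : k * (90 * l 3) <= _); first by rewrite leq_mul2l g2 orbT.
by rewrite mulnCA leq_mul2l.
Qed.

End BreadthFirst.

(** * Upper bound for the extremal number *)

Lemma ex_upper_bound (n k : nat) : 270 <= k -> 90 ^ 3 * n < k ^ 4 ->
  ex theta355 n <= 4 * (k * n).
Proof.
move=> k270 kn; apply/bigmax_leqP => E /andP[/forall_inP simpleE theta_free].
pose r : rel 'I_n := fun u v => [set u; v] \in E.
have r_sym : symmetric r by move=> u v; rewrite /r setUC.
have r_irr : irreflexive r.
  by move=> u; apply/negP => /simpleE; rewrite setUid cards1.
have cardE : #|E| <= edges_between r setT setT.
  pose a := [set u : 'I_n * 'I_n | r u.1 u.2].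
  have -> : edges_between r setT setT = #|a|.
    rewrite -sum1_card /edges_between.
    under eq_bigr do rewrite -sum1_card.
    rewrite pair_big_dep /=; apply: eq_bigl => -[u v].
    by rewrite in_nbrs !in_setT inE.
  apply: leq_trans (leq_imset_card (fun u => [set u.1; u.2]) _).
  apply/subset_leq_card/subsetP => e eE; have /cards2P[u [v [_ e_uv]]] := simpleE e eE.
  by apply/imsetP; exists (u, v); rewrite // inE /r /= -e_uv.
have [S _ cut] := dense_cut r_sym setT r_irr.
apply: leq_trans cardE (leq_trans cut _); rewrite leq_mul2l /= leqNgt; apply/negP => dense.
have [|A [B [sA sB /set0Pn[x xA] dA dB]]] := @min_degree_subpair _ _ r_sym k S (setT :\: S).
  suff -> : #|S| + #|[set: 'I_n] :\: S| = n by [].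
  by rewrite setTD cardsC card_ord.
(* Keeping only the edges between [A] and [B] makes the graph bipartite, with degree above [k] at
   every non-isolated vertex. *)
pose r' : rel 'I_n := fun u v => r u v && ((u \in A) && (v \in B) || (u \in B) && (v \in A)).
have inA u : u \in A -> u \in S := subsetP sA u.
have inB u : u \in B -> u \notin S by move/(subsetP sB); rewrite in_setD => /andP[].
have r'_sym : symmetric r'.
  by move=> u v; rewrite /r' r_sym orbC; congr (_ && (_ || _)); apply: andbC.
suff : k ^ 4 <= 90 ^ 3 * n by rewrite leqNgt kn.
rewrite -[n in _ * n]card_ord.
apply: (@min_degree_bound _ r' S x r'_sym) => //.
- move=> u v /andP[_ /orP[]/andP[]].
    by move=> /inA-> /inB; case: (v \in S).
  by move=> /inB + /inA ->; case: (u \in S).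
- move=> theta; case/negP: theta_free; apply/contains_theta355P.
  by apply: sub_has_theta theta => u v /andP[].
- have /card_gt0P[y] : 0 < #|nbrs r B x| by apply: leq_ltn_trans (dA x xA).
  by rewrite in_nbrs => /andP[yB rxy]; exists y; rewrite /r' rxy xA yB.
move=> u v /andP[_ /orP[]/andP[uS _]].
  apply: leq_trans (dA u uS) (subset_leq_card _); apply/subsetP => w.
  by rewrite !in_nbrs in_setT /r' uS => /andP[-> ->].
apply: leq_trans (dB u uS) (subset_leq_card _); apply/subsetP => w.
by rewrite !in_nbrs in_setT /r' uS => /andP[-> ->]; rewrite orbT.
Qed.

(* Choose [k] minimal with [M * n < k ^ 4]. *)
Lemma fourth_power_bound (f : nat -> nat) (K M : nat) : 1 < K -> 0 < M ->
    (forall n k, K <= k -> M * n < k ^ 4 -> f n <= 4 * (k * n)) ->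
  forall n, K ^ 4 <= n -> f n ^ 4 <= 8 ^ 4 * M * n ^ 5.
Proof.
move=> K_gt1 M_gt0 bound n le_n.
have exk : exists k, M * n < k ^ 4.
  exists (M * n).+1.
  by apply: leq_trans (leq_pexp2l (ltn0Sn _) (isT : 1 <= 4)); rewrite expn1.
case: (ex_minnP exk) => k kn min_k.
have Kk : K <= k.
  rewrite -(@leq_exp2r _ _ 4) //; apply: leq_trans le_n (ltnW (leq_ltn_trans _ kn)).
  by rewrite leq_pmull.
have k1 : k.-1 ^ 4 <= M * n.
  by rewrite leqNgt; apply/negP => /min_k; lia.
apply: (@leq_trans ((4 * (k * n)) ^ 4)); first by rewrite leq_exp2r // bound.
(* Since [k >= 2], [k] is at most twice [k.-1], and minimality bounds the latter. *)
apply: (@leq_trans ((8 * (k.-1 * n)) ^ 4)).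
  rewrite leq_exp2r // [8 * _]mulnA [4 * _]mulnA leq_mul2r; apply/orP; right; lia.
rewrite !expnMn -mulnA leq_mul2l; apply/orP; right.
by rewrite [n ^ 5]expnS mulnA leq_mul2r k1 orbT.
Qed.

Lemma ex_upper_bound_pow (n : nat) : 270 ^ 4 <= n ->
  ex theta355 n ^ 4 <= 8 ^ 4 * 90 ^ 3 * n ^ 5.
Proof.
apply: fourth_power_bound; [exact: isT | by rewrite expn_gt0 | exact: ex_upper_bound].
Qed.

(** * The point-line graph with directions on the moment curve *)

Section Wenger.
Import GRing.Theory.
Local Open Scope ring_scope.
Variable F : finFieldType.

(* A line is given by its slope [t] and its point [(0, y1, y2, y3)]; its
   direction is [(1, t, t^2, t^3)]. *)
Definition point : predArgType := (F * F * F * F)%type.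
Definition line : predArgType := (F * F * F * F)%type.

Definition line_through (t : F) (P : point) : line :=
  let: (x, y1, y2, y3) := P in
  (t, y1 - t * x, y2 - t ^+ 2 * x, y3 - t ^+ 3 * x).

Definition slope (l : line) : F := l.1.1.1.

Definition incident (P : point) (l : line) : bool := l == line_through (slope l) P.

Definition incidence (u v : point + line) : bool :=
  match u, v with
  | inl P, inr l => incident P l
  | inr l, inl P => incident P l
  | _, _ => false
  end.

Lemma incident_slope_inj P l m : incident P l -> incident P m ->
  slope l = slope m -> l = m.
Proof. by move=> /eqP hl /eqP hm e; rewrite hl hm e. Qed.

Lemma incident_displacement (x y1 y2 y3 x' y1' y2' y3' : F) l :
    incident (x, y1, y2, y3) l -> incident (x', y1', y2', y3') l ->
  [/\ y1' - y1 = slope l * (x' - x), y2' - y2 = slope l ^+ 2 * (x' - x)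
    & y3' - y3 = slope l ^+ 3 * (x' - x)].
Proof.
case: l => [[[t b1] b2] b3]; rewrite /incident /slope /= => /eqP[-> -> ->] /eqP[e1 e2 e3].
have shift (s a b c d : F) : a - s * c = b - s * d -> b - a = s * (d - c).
  move=> e; have -> : b = b - s * d + s * d by ring.
  by rewrite -e; ring.
by split; apply: shift.
Qed.

(* Summing the four displacements around the octagon against the cubic
   vanishing at the slopes of [l1], [l2], [l3] leaves only the term of [m]. *)
Lemma octagon_slope (P P1 P2 P3 : point) (l1 l2 l3 m : line) :
    incident P l1 -> incident P1 l1 -> incident P1 m -> incident P3 m ->
    incident P3 l3 -> incident P2 l3 -> incident P2 l2 -> incident P l2 ->
  P1 != P3 -> m != l1 -> m != l3 -> slope m = slope l2.
Proof.
move=> Pl1 P1l1 P1m P3m P3l3 P2l3 P2l2 Pl2 P13 ml1 ml3.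
have {ml1} ml1 : slope m != slope l1.
  by apply: contraNneq ml1 => /(incident_slope_inj P1m P1l1)->.
have {ml3} ml3 : slope m != slope l3.
  by apply: contraNneq ml3 => /(incident_slope_inj P3m P3l3)->.
move: P P1 P2 P3 Pl1 P1l1 P1m P3m P3l3 P2l3 P2l2 Pl2 P13.
move=> [[[x y] z] u] [[[x1 y1] z1] u1] [[[x2 y2] z2] u2] [[[x3 y3] z3] u3].
move=> Pl1 P1l1 P1m P3m P3l3 P2l3 P2l2 Pl2 P13.
have [a1 a2 a3] := incident_displacement Pl1 P1l1.
have [b1 b2 b3] := incident_displacement P1m P3m.
have [c1 c2 c3] := incident_displacement P3l3 P2l3.
have [d1 d2 d3] := incident_displacement P2l2 Pl2.
move: (slope m) (slope l1) (slope l2) (slope l3) ml1 ml3 a1 a2 a3 b1 b2 b3 c1 c2 c3 d1 d2 d3.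
move=> t t1 t2 t3 tt1 tt3 a1 a2 a3 b1 b2 b3 c1 c2 c3 d1 d2 d3.
(* Both points lie on [m], so equal first coordinates would make them equal. *)
have x13 : x3 - x1 != 0.
  apply: contraNneq P13 => e; move: b1 b2 b3; rewrite e !mulr0.
  by move: e => /subr0_eq-> /subr0_eq-> /subr0_eq-> /subr0_eq->.
have : (x3 - x1) * (t - t1) * (t - t3) * (t - t2) == 0.
  (* The coefficients are those of the cubic; its constant term is absent because the differences of
     first coordinates sum to 0. *)
  apply/eqP; transitivity
    ((t1 ^+ 3 * (x1 - x) + t ^+ 3 * (x3 - x1) + t3 ^+ 3 * (x2 - x3) + t2 ^+ 3 * (x - x2))
     - (t1 + t2 + t3) * (t1 ^+ 2 * (x1 - x) + t ^+ 2 * (x3 - x1) + t3 ^+ 2 * (x2 - x3) + t2 ^+ 2 * (x - x2))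
     + (t1 * t2 + t2 * t3 + t3 * t1) * (t1 * (x1 - x) + t * (x3 - x1) + t3 * (x2 - x3) + t2 * (x - x2))).
    by ring.
  by rewrite -a1 -a2 -a3 -b1 -b2 -b3 -c1 -c2 -c3 -d1 -d2 -d3; ring.
by rewrite !mulf_eq0 !subr_eq0 -subr_eq0 (negPf x13) (negPf tt1) (negPf tt3) => /eqP.
Qed.

(** The octagons through [l1], [m] and [l3], respectively [l5], make [l2] and [l4] parallel to [m];
    both pass through [P], so they coincide. *)
Lemma no_theta_through_point (P P1 P2 P3 P4 P5 : point) (m l1 l2 l3 l4 l5 : line) :
    incident P l1 -> incident P1 l1 -> incident P1 m ->
    incident P l2 -> incident P2 l2 -> incident P2 l3 -> incident P3 l3 -> incident P3 m ->
    incident P l4 -> incident P4 l4 -> incident P4 l5 -> incident P5 l5 -> incident P5 m ->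
  P1 != P3 -> P1 != P5 -> m != l1 -> m != l3 -> m != l5 -> l2 != l4 -> False.
Proof.
move=> i1 i2 i3 j1 j2 j3 j4 j5 k1 k2 k3 k4 k5 n13 n15 nm1 nm3 nm5 /eqP; apply.
apply: (incident_slope_inj j1 k1).
by rewrite -(octagon_slope i1 i2 i3 j5 j4 j3 j2 j1) // -(octagon_slope i1 i2 i3 k5 k4 k3 k2 k1).
Qed.

Lemma incidence_theta_free : ~ has_theta incidence.
Proof.
move=> [w [w' [x1 [x2 [y1 [y2 [y3 [y4 [z1 [z2 [z3 [z4 [U px py pz]]]]]]]]]]]]].
have ne (i j : nat) : (i < 12)%N -> (j < 12)%N -> i != j ->
    nth w [:: w; w'; x1; x2; y1; y2; y3; y4; z1; z2; z3; z4] i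
      != nth w [:: w; w'; x1; x2; y1; y2; y3; y4; z1; z2; z3; z4] j.
  by move=> lti ltj ij; rewrite nth_uniq.
have {ne} [[n1 n2] n3 n4 n5 n6] : [/\ (x2 != y4 /\ x1 != y1) /\ (x2 != z4 /\ x1 != z1),
    w' != x1 /\ w != x2, w' != y3 /\ w != y2, w' != z3 /\ w != z2 & y1 != z1 /\ y4 != z4].
  repeat split; [exact: (ne 3 7) | exact: (ne 2 4) | exact: (ne 3 11) | exact: (ne 2 8)
    | exact: (ne 1 2) | exact: (ne 0 3) | exact: (ne 1 6) | exact: (ne 0 5)
    | exact: (ne 1 10) | exact: (ne 0 9) | exact: (ne 4 8) | exact: (ne 7 11)].
move: n1 n2 n3 n4 n5 n6 px py pz => /= {U}.
(* The paths have odd length, so one end is a point and the other a line. If [w] is the line, the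
   paths are read backwards. *)
case: w => [P|m].
  case: x1 => [|l1]; case: x2 => [P1|]; rewrite /= ?andbF //.
  case: w' => [|m]; rewrite /= ?andbF //.
  case: y1 => [|l2]; case: y2 => [P2|]; rewrite /= ?andbF //.
  case: y3 => [|l3]; case: y4 => [P3|]; rewrite /= ?andbF //.
  case: z1 => [|l4]; case: z2 => [P4|]; rewrite /= ?andbF //.
  case: z3 => [|l5]; case: z4 => [P5|]; rewrite /= ?andbF //.
  move=> [n1 _] [n2 _] [n3 _] [n4 _] [n5 _] [n6 _].
  move=> /and4P[i1 i2 i3 _] /and5P[j1 j2 j3 j4 /andP[j5 _]].
  move=> /and5P[k1 k2 k3 k4 /andP[k5 _]].
  exact: no_theta_through_point i1 i2 i3 j1 j2 j3 j4 j5 k1 k2 k3 k4 k5 _ _ _ _ _ _.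
case: x1 => [P1|]; case: x2 => [|l1]; rewrite /= ?andbF //.
case: w' => [P|]; rewrite /= ?andbF //.
case: y1 => [P3|]; case: y2 => [|l3]; rewrite /= ?andbF //.
case: y3 => [P2|]; case: y4 => [|l2]; rewrite /= ?andbF //.
case: z1 => [P5|]; case: z2 => [|l5]; rewrite /= ?andbF //.
case: z3 => [P4|]; case: z4 => [|l4]; rewrite /= ?andbF //.
move=> [_ n1] [_ n2] [_ n3] [_ n4] [_ n5] [_ n6].
move=> /and4P[i3 i2 i1 _] /and5P[j5 j4 j3 j2 /andP[j1 _]].
move=> /and5P[k5 k4 k3 k2 /andP[k1 _]].
exact: no_theta_through_point i1 i2 i3 j1 j2 j3 j4 j5 k1 k2 k3 k4 k5 _ _ _ _ _ _.
Qed.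

(** A flag amounts to a point and a slope. *)
Lemma incidence_flags : #|[set u : point * line | incident u.1 u.2]| = (#|F| ^ 5)%N.
Proof.
have -> : [set u : point * line | incident u.1 u.2] =
    [set (v.1, line_through v.2 v.1) | v : point * F].
  apply/setP => -[P l]; rewrite inE /=; apply/idP/imsetP => [/eqP e|[[P' t] _ [-> ->]]].
    by exists (P, slope l); rewrite //= -e.
  by rewrite /incident; case: P' => [[[]]].
rewrite card_imset; first by rewrite !card_prod !expnS expn0 muln1 !mulnA.
by move=> [[[[x y] z] u] t] [[[[x' y'] z'] u'] t'] [-> -> -> ->] /= [->].
Qed.

End Wenger.

(** * Lower bound for the extremal number *)

(** The set [a] holds edges with one orientation each; [T] is embedded in ['I_n], leaving the
    remaining vertices isolated. *)
Lemma ex_ge (n : nat) (T : finType) (r : rel T) (a : {set T * T}) :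
    irreflexive r -> symmetric r -> #|T| <= n -> ~ has_theta r ->
    {in a, forall u, r u.1 u.2} ->
    {in a &, injective (fun u => [set u.1; u.2])} ->
  #|a| <= ex theta355 n.
Proof.
move=> irr sym leTn no_theta ar a_inj.
have [g g_inj] : exists g : T -> 'I_n, injective g.
  exists (fun x => widen_ord leTn (enum_rank x)).
  by move=> x y /(congr1 val) /= /val_inj /enum_rank_inj.
pose E := [set [set g u.1; g u.2] | u in a].
have setg (x y : T) : [set g x; g y] = g @: [set x; y] by rewrite imsetU !imset_set1.
have cardE : #|E| = #|a|.
  apply: card_in_imset => u v ua va; rewrite !setg => /(imset_inj g_inj).
  exact: a_inj.
have adjE (i j : 'I_n) : [set i; j] \in E -> exists x y, [/\ i = g x, j = g y & r x y].
  move=> /imsetP[[x y] /ar /= rxy e].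
  have gxy : g x != g y by apply: contraTneq rxy => /g_inj->; rewrite irr.
  have : g y \in [set i; j] by rewrite e set22.
  have : g x \in [set i; j] by rewrite e set21.
  have : j \in [set g x; g y] by rewrite -e set22.
  have : i \in [set g x; g y] by rewrite -e set21.
  rewrite !in_set2 => /orP[]/eqP-> /orP[]/eqP->.
  - by rewrite !orbb => _; rewrite eq_sym (negPf gxy).
  - by move=> _ _; exists x, y.
  - by move=> _ _; exists y, x; rewrite sym.
  - by rewrite !orbb (negPf gxy).
(* Every edge of [E] has both ends in the image of [g], so paths pull back to [T]. *)
have lift s x : path (fun u v => [set u; v] \in E) (g x) s ->
    exists2 t, s = map g t & path r x t.
  elim: s x => [|j s IHs] x /=; first by exists [::].
  case/andP => /adjE[x' [y [/g_inj<- -> rxy]]] /IHs[t -> pt].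
  by exists (y :: t); rewrite //= rxy.
rewrite -cardE; apply: (@leq_bigmax_cond _ _ (fun E : {set {set 'I_n}} => #|E|)).
apply/andP; split.
  apply/forall_inP => e /imsetP[u ua ->]; rewrite cards2.
  suff -> : g u.1 != g u.2 by [].
  by apply: contraTneq (ar u ua) => /g_inj->; rewrite irr.
apply/contains_theta355P => -[w [w' [x1 [x2 [y1 [y2 [y3 [y4 [z1 [z2 [z3 [z4]]]]]]]]]]]].
case=> U px py pz; apply: no_theta.
have /andP[/adjE[v [_ [ew _ _]]] _] := px; subst w.
have [[|x1' [|x2' [|v' [|? ?]]]] //] := lift _ _ px; case=> ? ? ? px'; subst x1 x2 w'.
have [[|y1' [|y2' [|y3' [|y4' [|v'' [|? ?]]]]]] //] := lift _ _ py.
case=> ? ? ? ? /g_inj ? py'; subst y1 y2 y3 y4 v''.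
have [[|z1' [|z2' [|z3' [|z4' [|v'' [|? ?]]]]]] //] := lift _ _ pz.
case=> ? ? ? ? /g_inj ? pz'; subst z1 z2 z3 z4 v''.
exists v, v', x1', x2', y1', y2', y3', y4', z1', z2', z3', z4'; split=> //.
by rewrite -(map_inj_uniq g_inj).
Qed.

Lemma ex_ge_field (F : finFieldType) (n : nat) : 2 * #|F| ^ 4 <= n ->
  #|F| ^ 5 <= ex theta355 n.
Proof.
move=> le_n; rewrite -incidence_flags.
pose flags := [set u : point F * line F | incident u.1 u.2].
pose f (u : point F * line F) : (point F + line F) * (point F + line F) := (inl u.1, inr u.2).
have f_inj : injective f by move=> [x y] [x' y'] [-> ->].
rewrite -(card_imset _ f_inj).
apply: (@ex_ge n _ (@incidence F)).
- by case.
- by case=> [P|l] [Q|m].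
- by apply: leq_trans le_n; rewrite card_sum !card_prod mul2n -addnn !expnS expn0 muln1 !mulnA.
- exact: incidence_theta_free.
- by move=> _ /imsetP[u uI ->]; rewrite inE in uI.
move=> _ _ /imsetP[[P l] _ ->] /imsetP[[Q m] _ ->] /= e.
have : inl P \in [set inl Q; inr m : point F + line F] by rewrite -e set21.
have : inr l \in [set inl Q; inr m : point F + line F] by rewrite -e set22.
by rewrite !in_set2 /= orbF => /eqP[->] /eqP[->].
Qed.

(** The field has order [2 ^ k], where [16 ^ k], its fourth power, is the largest power of 16 up to
    [n./2]; hence [n] is below 32 times that power. The bound 32 ensures [k > 0]. *)
Lemma ex_lower_bound (n : nat) : 32 <= n -> n ^ 5 <= 32 ^ 5 * ex theta355 n ^ 4.
Proof.
move=> le_n; pose k := trunc_log 16 n./2.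
have k_gt0 : 0 < k by rewrite trunc_log_gt0; lia.
have [F _ cardF] := PrimePowerField (isT : prime 2) k_gt0.
have /andP[lo hi] : 16 ^ k <= n./2 < 16 ^ k.+1 by apply: trunc_log_bounds; lia.
have q4 : 16 ^ k = #|F| ^ 4 by rewrite cardF -expnM mulnC expnM.
have lo' : 2 * #|F| ^ 4 <= n by lia.
have hi' : n <= 32 * #|F| ^ 4 by move: hi; rewrite expnS q4; lia.
apply: (@leq_trans ((32 * #|F| ^ 4) ^ 5)); first by rewrite leq_exp2r.
rewrite expnMn leq_mul2l -expnM mulnC expnM leq_exp2r // ex_ge_field // orbT.
Qed.

(* Passage to real exponents by comparing fourth powers *)
From Stdlib Require Import Reals Lra Field.
Open Scope R_scope.

Lemma INR_expn (m k : nat) : INR (expn m k) = INR m ^ k.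
Proof.
elim: k => [|k IHk]; first by rewrite expn0.
by rewrite expnS mult_INR IHk.
Qed.

Lemma pow4_le_inv (x y : R) : 0 <= x -> 0 <= y -> x ^ 4 <= y ^ 4 -> x <= y.
Proof.
move=> x0 y0 le; case: (Rle_or_lt x y) => // lt_yx.
have h2 : y ^ 2 < x ^ 2 by nra.
have y2 : 0 <= y ^ 2 by nra.
have h4 : (y ^ 2) ^ 2 < (x ^ 2) ^ 2 by nra.
by move: h4; rewrite -!pow_mult /=; lra.
Qed.

Lemma Rpower_pow4 (x a : R) : 0 < x -> Rpower x (a / 4) ^ 4 = Rpower x a.
Proof.
move=> x0; rewrite -Rpower_pow ?Rpower_mult; last exact: exp_pos.
by congr Rpower; simpl; field.
Qed.

Lemma INR_mul_pow (m c n i j : nat) : leq (expn m i) (muln c (expn n j)) ->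
  INR m ^ i <= INR c * INR n ^ j.
Proof. by move=> /leP/le_INR; rewrite mult_INR !INR_expn. Qed.

Theorem theorem1p2 :
  exists (c C : R) (N : nat), 0 < c /\ 0 < C /\
    forall n : nat, (N <= n)%nat ->
      c * Rpower (INR n) (5/4) <= INR (ex theta355 n) /\
      INR (ex theta355 n) <= C * Rpower (INR n) (5/4).
Proof.
have [N N_gt270 N_ge32] : exists2 N, leq (expn 270 4) N & leq 32 N.
  by exists (addn (expn 270 4) 32); [apply: leq_addr | apply: leq_addl].
pose c := INR (expn 32 5); pose C := INR (muln (expn 8 4) (expn 90 3)).
have c_gt0 : 0 < c by apply/lt_0_INR/ltP; rewrite expn_gt0.
have C_gt0 : 0 < C by apply/lt_0_INR/ltP; rewrite muln_gt0 !expn_gt0.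
(* Fourth roots of the constants in the two bounds on [ex theta355 n ^ 4]. *)
exists (Rpower (/ c) (1/4)), (Rpower C (1/4)), N.
split; first exact: exp_pos.
split; first exact: exp_pos.
move=> n le_Nn.
have n_gt0 : 0 < INR n.
  by apply/lt_0_INR/ltP; apply: leq_trans le_Nn; apply: leq_trans N_ge32.
have pow_n : Rpower (INR n) (5/4) ^ 4 = INR n ^ 5.
  by rewrite Rpower_pow4 // -Rpower_pow //; congr Rpower; simpl; ring.
have ex0 := pos_INR (ex theta355 n).
split; apply: pow4_le_inv => //.
- by apply: Rmult_le_pos; apply: Rlt_le; apply: exp_pos.
- rewrite Rpow_mult_distr pow_n Rpower_pow4 ?Rpower_1; try exact: Rinv_0_lt_compat.
  apply: (Rmult_le_reg_l c) => //; rewrite -Rmult_assoc Rinv_r ?Rmult_1_l; last lra.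
  by apply/INR_mul_pow/ex_lower_bound; apply: leq_trans le_Nn.
- by apply: Rmult_le_pos; apply: Rlt_le; apply: exp_pos.
rewrite Rpow_mult_distr pow_n Rpower_pow4 // Rpower_1 //.
by apply/INR_mul_pow/ex_upper_bound_pow; apply: leq_trans le_Nn.
Qed.
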